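(* Let $k$ be a field of characteristic not two. For every integer $m > 2$, $C(m,k) = \frac{1}{2}\varphi(m)$ or $C(m,k) = 0$. Moreover, $C(2,k) = |k^*/(k^* )^2|$.
   Context: $\overline{k}$ is the algebraic closure of $k$, $k^*$ is the multiplicative group of $k$, $(k^* )^2$ is its subgroup of squares, and $\varphi$ is Euler's totient function. For $A \in \mathrm{GL}(2,\overline{k})$, $\operatorname{Inn}_A$ denotes the map $X \mapsto A^{-1}XA$. An automorphism of $\mathrm{SL}(2,k)$ means a $k$-automorphism, i.e. an automorphism of the algebraic group $\mathrm{SL}_2$ (equivalently of $\mathrm{SL}(2,\overline{k})$ as an algebraic group) which leaves $\mathrm{SL}(2,k)$ invariant. Two automorphisms $\theta,\tau$ of $\mathrm{SL}(2,k)$ are isomorphic (over $\mathrm{GL}(2,k)$) if there is $Q \in \mathrm{GL}(2,k)$ such that $\tau = \operatorname{Inn}_Q^{-1}\,\theta\,\operatorname{Inn}_Q$; the equivalence classes are called isomorphy classes. $C(m,k)$ denotes the number of isomorphy classes of automorphisms of $\mathrm{SL}(2,k)$ of order (exactly) $m$.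
   Formalization: The case m = char(k) = p ≥ 5 is excluded from the first claim, since there C(p,k) = 1 (one class of unipotent type), which is neither 0 nor φ(p)/2; for example C(5,F_5) = 1 while φ(5)/2 = 2. *)

(* Defs.v *)
From HB Require Import structures.
From mathcomp Require Import all_boot all_order all_algebra.
From mathcomp Require Import all_classical.
From mathcomp Require Import mpoly.

Set Implicit Arguments.
Unset Strict Implicit.
Unset Printing Implicit Defensive.

Import GRing.Theory.
Local Open Scope classical_set_scope.
Local Open Scope ring_scope.

Record SL2 (F : fieldType) := MkSL2 {
  SL2val :> 'M[F]_2;
  SL2valP : \det SL2val == 1
}.

HB.instance Definition _ (F : fieldType) := [isSub for @SL2val F].
HB.instance Definition _ (F : fieldType) := [Choice of SL2 F by <:].

Section SL2Group.
Variable F : fieldType.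
Implicit Types X Y : SL2 F.

Fact SL2_one_subproof : \det (1%:M : 'M[F]_2) == 1.
Proof. by rewrite det1. Qed.

Fact SL2_mul_subproof X Y : \det (val X *m val Y) == 1.
Proof. by rewrite det_mulmx (eqP (SL2valP X)) (eqP (SL2valP Y)) mulr1. Qed.

Fact SL2_inv_subproof X : \det (invmx (val X)) == 1.
Proof. by rewrite det_inv (eqP (SL2valP X)) invr1. Qed.

Definition SL2_one : SL2 F := MkSL2 SL2_one_subproof.
Definition SL2_mul X Y : SL2 F := MkSL2 (SL2_mul_subproof X Y).
Definition SL2_inv X : SL2 F := MkSL2 (SL2_inv_subproof X).

Lemma SL2_unitmx X : val X \in unitmx.
Proof. by rewrite unitmxE (eqP (SL2valP X)) unitr1. Qed.

Fact SL2_mulA : associative SL2_mul.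
Proof. by move=> X Y Z; apply: val_inj; exact: mulmxA. Qed.
Fact SL2_mul1 : left_id SL2_one SL2_mul.
Proof. by move=> X; apply: val_inj; exact: mul1mx. Qed.
Fact SL2_mulr1 : right_id SL2_one SL2_mul.
Proof. by move=> X; apply: val_inj; exact: mulmx1. Qed.
Fact SL2_mulV : left_inverse SL2_one SL2_inv SL2_mul.
Proof. by move=> X; apply: val_inj; exact: (mulVmx (SL2_unitmx X)). Qed.
Fact SL2_mulrV : right_inverse SL2_one SL2_inv SL2_mul.
Proof. by move=> X; apply: val_inj; exact: (mulmxV (SL2_unitmx X)). Qed.

HB.instance Definition _ :=
  isGroup.Build (SL2 F) SL2_mulA SL2_mul1 SL2_mulr1 SL2_mulV SL2_mulrV.

(* The default value X of insubd is only reached when A is singular. *)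
Definition Inn (A : 'M[F]_2) X : SL2 F := insubd X (invmx A *m val X *m A).

Lemma val_Inn A X : A \in unitmx -> val (Inn A X) = invmx A *m val X *m A.
Proof.
move=> uA; rewrite /Inn insubdK // unfold_in.
rewrite !det_mulmx (eqP (SL2valP X)) mulr1 -det_mulmx mulVmx //.
by rewrite det1.
Qed.

(* Regular maps of the affine variety SL_2 inside the affine space of 2 x 2
   matrices: each entry is a polynomial in the four entries of X. *)
Definition SL2_regular (f : SL2 F -> SL2 F) : Prop :=
  exists P : 'M[{mpoly F[2 * 2]}]_2,
    forall X i j, val (f X) i j = (P i j).@[fun t => mxvec (val X) 0 t].

(* A bijective regular homomorphism need not have a regular inverse (Frobenius),
   so regularity of the inverse is part of the definition. *)
Definition SL2_algaut (f : SL2 F -> SL2 F) : Prop :=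
  [/\ {morph f : X Y / (X * Y)%g}, SL2_regular f &
      exists g, [/\ cancel f g, cancel g f & SL2_regular g]].

End SL2Group.

Definition has_order (T : Type) (f : T -> T) (m : nat) : Prop :=
  [/\ (0 < m)%N, iter m f =1 id &
      forall n, (0 < n < m)%N -> ~ (iter n f =1 id)].

Section Automorphisms.
(* K is meant to be an algebraic closure of k, embedded by iota. *)
Variables (k : fieldType) (K : closedFieldType) (iota : {rmorphism k -> K}).

Definition SL2_rational : set (SL2 K) :=
  [set X | exists Y : SL2 k, map_mx iota (val Y) = val X].

Definition kaut (f : SL2 K -> SL2 K) : Prop :=
  SL2_algaut f /\ f @` SL2_rational = SL2_rational.

Definition isomorphic (theta tau : SL2 K -> SL2 K) : Prop :=
  exists2 Q : 'M[k]_2, Q \in unitmx &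
    tau = Inn (invmx (map_mx iota Q)) \o theta \o Inn (map_mx iota Q).

Definition isomorphy_classes (m : nat) : set (set (SL2 K -> SL2 K)) :=
  [set C | exists theta, [/\ kaut theta, has_order theta m &
    C = [set tau | kaut tau /\ isomorphic theta tau]]].

End Automorphisms.

(* The elements of k^* / (k^* )^2, as cosets. *)
Definition square_classes (k : fieldType) : set (set k) :=
  [set C | exists2 a : k, a != 0 &
    C = [set b | exists2 t : k, t != 0 & b = a * t ^+ 2]].
Arguments square_classes k : clear implicits.

(* Main.v *)
(* Every k-automorphism of SL_2 is conjugation by some A in GL(2,k), so the
   isomorphy classes are the conjugacy classes of PGL(2,k).

   Innerness over K: an automorphism f maps upper unitriangular matrices u(t) to
   matrices of trace 2, since t |-> tr f(u(t)) is a polynomial, constant on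
   K^*.  After conjugation f fixes u(1), hence preserves its centralizer and
   acts on {u(t)} by a polynomial with polynomial inverse, so f(u(t)) = u(t).  A
   further unipotent conjugation makes f act on the lower unitriangular matrices
   by a scalar, which the relation w^2 = -1 for the Weyl element forces to be 1.
   Conjugation by A preserves SL(2,k) only if A is proportional to a matrix
   over k, because all products of two entries of A, divided by det A, lie in k.

   Conjugacy in PGL(2,k): a nonscalar A is similar to its companion matrix, and
   A^n is scalar iff u_n = 0, u being the Lucas sequence of (tr A, det A).  Order
   2 means tr A = 0, and then -det A modulo squares classifies A.  For m > 2 one
   can scale to tr A = 1, so det A classifies A; it is z / (1 + z)^2 for the ratio
   z of the eigenvalues, a primitive m-th root of unity.  If one such value lies
   in k then all do, and z, z^-1 give the same one: there are phi(m)/2 of them. *)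

Require Import Defs.
From HB Require Import structures.
From mathcomp Require Import all_boot all_order all_algebra.
From mathcomp Require Import all_classical.
From mathcomp Require Import mpoly ring zify.

Set Implicit Arguments.
Unset Strict Implicit.
Unset Printing Implicit Defensive.

Import GRing.Theory.
Local Open Scope classical_set_scope.
Local Open Scope card_scope.
Local Open Scope ring_scope.

(** * Explicit 2 x 2 matrices *)

Section Matrices2.
Variable R : comNzRingType.
Implicit Types (A B : 'M[R]_2) (a b c d : R).

Definition mx2 a b c d : 'M[R]_2 :=
  \matrix_(i, j) if i == 0 then if j == 0 then a else b
                 else if j == 0 then c else d.

Lemma mx2E A : A = mx2 (A 0 0) (A 0 1) (A 1 0) (A 1 1).
Proof.
apply/matrixP=> -[[|[|//]] ?] [[|[|//]] ?]; rewrite mxE /=; congr (A _ _);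
  exact: val_inj.
Qed.

Lemma mx2_inj a b c d a' b' c' d' : mx2 a b c d = mx2 a' b' c' d' ->
  [/\ a = a', b = b', c = c' & d = d'].
Proof.
move=> /matrixP e.
by split; [have := e 0 0 | have := e 0 1 | have := e 1 0 | have := e 1 1];
  rewrite !mxE.
Qed.

Lemma mulmx2 a b c d a' b' c' d' : mx2 a b c d *m mx2 a' b' c' d' =
  mx2 (a * a' + b * c') (a * b' + b * d') (c * a' + d * c') (c * b' + d * d').
Proof. by rewrite [LHS]mx2E !mxE !big_ord_recl !big_ord0 !mxE /= !addr0. Qed.

Lemma scalemx2 x a b c d : x *: mx2 a b c d = mx2 (x * a) (x * b) (x * c) (x * d).
Proof. by rewrite [LHS]mx2E !mxE. Qed.

Lemma addmx2 a b c d a' b' c' d' : mx2 a b c d + mx2 a' b' c' d' =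
  mx2 (a + a') (b + b') (c + c') (d + d').
Proof. by rewrite [LHS]mx2E !mxE. Qed.

Lemma scalar_mx2 a : a%:M = mx2 a 0 0 a.
Proof. by rewrite [LHS]mx2E !mxE /= !mulr0n !mulr1n. Qed.

Lemma det_mx2E a b c d : \det (mx2 a b c d) = a * d - b * c.
Proof. rewrite (expand_det_row _ 0) !big_ord_recl big_ord0 /cofactor !det_mx11 !mxE /=.
by rewrite expr0 expr1 mul1r mulN1r mulrN addr0. Qed.

Lemma tr_mx2E a b c d : \tr (mx2 a b c d) = a + d.
Proof. by rewrite /mxtrace !big_ord_recl big_ord0 !mxE /= addr0. Qed.

Lemma mx2_Cayley_Hamilton A : A *m A = \tr A *: A - (\det A)%:M.
Proof.
rewrite (mx2E A) mulmx2 tr_mx2E det_mx2E scalemx2 scalar_mx2 -scaleN1r scalemx2 addmx2.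
congr mx2; ring.
Qed.

End Matrices2.

Lemma map_mx2 (R S : comNzRingType) (f : {rmorphism R -> S}) a b c d :
  map_mx f (mx2 a b c d) = mx2 (f a) (f b) (f c) (f d).
Proof. by rewrite [LHS]mx2E !mxE. Qed.

(** * Similarity of nonscalar matrices *)

Section Companion.
Variable F : fieldType.
Implicit Types (A B Q : 'M[F]_2) (t d : F).

Lemma invmx2 (a b c d : F) : a * d - b * c != 0 ->
  invmx (mx2 a b c d) = (a * d - b * c)^-1 *: mx2 d (- b) (- c) a.
Proof.
move=> nz; set D := a * d - b * c.
have h : mx2 a b c d *m (D^-1 *: mx2 d (- b) (- c) a) = 1%:M.
  by rewrite -scalemxAr mulmx2 scalemx2 scalar_mx2; congr mx2; rewrite /D; field.
have u : mx2 a b c d \in unitmx by rewrite unitmxE det_mx2E unitfE.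
by rewrite -[RHS](mulKmx u) h mulmx1.
Qed.

Definition companion2 t d : 'M[F]_2 := mx2 0 (- d) 1 t.

Lemma companion2_similar A : ~~ is_scalar_mx A ->
  exists2 Q, Q \in unitmx & A *m Q = Q *m companion2 (\tr A) (\det A).
Proof.
rewrite (mx2E A); move: (A 0 0) (A 0 1) (A 1 0) (A 1 1) => a b c d nA.
(* The quadratic form is det (v | A v) at v = (x, y), so where it is nonzero v is a cyclic vector. A
   form vanishing at (1, 0), (0, 1) and (1, 1) has c = b = 0 and a = d. *)
have cyc x y : c * x ^+ 2 + (d - a) * x * y - b * y ^+ 2 != 0 ->
    exists2 Q, Q \in unitmx & mx2 a b c d *m Q =
      Q *m companion2 (\tr (mx2 a b c d)) (\det (mx2 a b c d)).
  move=> nz; exists (mx2 x (a * x + b * y) y (c * x + d * y)).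
    rewrite unitmxE det_mx2E unitfE; apply: contra nz => /eqP e; apply/eqP.
    by rewrite -e; ring.
  by rewrite /companion2 tr_mx2E det_mx2E !mulmx2; congr mx2; ring.
have [c0|c0] := eqVneq c 0; last first.
  by apply: (cyc 1 0); rewrite expr1n mulr0 expr0n /= !mulr0 subr0 addr0 mulr1.
have [b0|b0] := eqVneq b 0; last first.
  by apply: (cyc 0 1); rewrite expr1n expr0n /= !mulr0 mul0r !add0r mulr1 oppr_eq0.
apply: (cyc 1 1); rewrite c0 b0 !mulr1 !mul0r add0r subr0.
apply: contra nA; rewrite subr_eq0 => /eqP ->.
by rewrite c0 b0 -scalar_mx2 scalar_mx_is_scalar.
Qed.

Lemma similar2 A B : ~~ is_scalar_mx A -> ~~ is_scalar_mx B ->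
  \tr A = \tr B -> \det A = \det B ->
  exists2 Q, Q \in unitmx & B *m Q = Q *m A.
Proof.
move=> nA nB tAB dAB.
have [P uP eP] := companion2_similar nA.
have [Q uQ eQ] := companion2_similar nB.
exists (Q *m invmx P); first by rewrite unitmx_mul uQ unitmx_inv.
rewrite mulmxA eQ -tAB -dAB -!mulmxA; congr (_ *m _).
by rewrite -[LHS](mulKmx uP) (mulmxA P) -eP -!mulmxA (mulmxV uP) mulmx1.
Qed.

End Companion.

(** * Unipotent generators, conjugations, and polynomial curves in SL_2 *)

Section InnerAutomorphisms.
Variable F : fieldType.
Implicit Types (A B : 'M[F]_2) (X Y : SL2 F).

Fact upper_subproof (t : F) : \det (mx2 1 t 0 1) == 1.
Proof. by rewrite det_mx2E mulr1 mulr0 subr0. Qed.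

Fact lower_subproof (t : F) : \det (mx2 1 0 t 1) == 1.
Proof. by rewrite det_mx2E mulr1 mul0r subr0. Qed.

Definition upper (t : F) : SL2 F := MkSL2 (upper_subproof t).
Definition lower (t : F) : SL2 F := MkSL2 (lower_subproof t).

Lemma SL2_mx2P X : exists a b c d,
  val X = mx2 a b c d /\ a * d - b * c = 1.
Proof.
do 4!eexists; split; first exact: mx2E.
by rewrite -det_mx2E -mx2E (eqP (SL2valP X)).
Qed.

Lemma SL2_valM X Y : val (X * Y)%g = val X *m val Y. Proof. by []. Qed.

Lemma SL2_val1 : val (1%g : SL2 F) = 1%:M. Proof. by []. Qed.

Lemma upperD s t : upper (s + t) = (upper s * upper t)%g.
Proof. by apply: val_inj; rewrite SL2_valM /= mulmx2; congr mx2; ring. Qed.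

Lemma upper0 : upper 0 = 1%g.
Proof. by apply: val_inj; rewrite SL2_val1 scalar_mx2. Qed.

(** Unipotents generate: if the lower left entry is nonzero, X is a product upper, lower, upper. If
    it is zero, the lower right entry is a unit and becomes the lower left entry of
    [X * lower 1]. *)
Lemma upper_lower_gen (f : SL2 F -> SL2 F) : {morph f : X Y / (X * Y)%g} ->
  (forall t, f (upper t) = upper t) -> (forall t, f (lower t) = lower t) ->
  f =1 id.
Proof.
move=> fM fu fl.
have gen X : val X 1 0 != 0 -> f X = X.
  have [a [b [c [d [eX e]]]]] := SL2_mx2P X; rewrite eX mxE /= => c0.
  suff -> : X = (upper ((a - 1) / c) * lower c * upper ((d - 1) / c))%g.
    by rewrite !fM !fu fl.
  apply: val_inj; rewrite !SL2_valM /= !mulmx2 eX.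
  have -> : b = (a * d - 1) / c by rewrite -e; field.
  by congr mx2; field.
move=> X; have [e|] := eqVneq (val X 1 0) 0; last exact: gen.
suff eXl : f (X * lower 1)%g = (X * lower 1)%g.
  by move: eXl; rewrite fM fl => /mulIg.
apply: gen; have [a [b [c [d [eX e1]]]]] := SL2_mx2P X.
move: e; rewrite SL2_valM /= eX mulmx2 !mxE /= => c0.
move: e1; rewrite c0 mulr0 subr0 mulr1 add0r mulr1 => e1.
by apply: contra_eqN e1 => /eqP ->; rewrite mulr0 eq_sym oner_eq0.
Qed.

Lemma mx2_comm_scalar A : A *m val (upper 1) = val (upper 1) *m A ->
  A *m val (lower 1) = val (lower 1) *m A -> is_scalar_mx A.
Proof.
rewrite /= (mx2E A) !mulmx2 => /mx2_inj [e1 e2 _ _] /mx2_inj [e3 _ _ _].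
apply/is_scalar_mxP; exists (A 0 0); rewrite scalar_mx2; congr mx2.
- by move: e3; rewrite !mulr1 mul1r mul0r addr0 -[RHS]addr0 => /addrI.
- by move: e1; rewrite !mulr1 mul1r mulr0 addr0 mul1r -[LHS]addr0 => /addrI.
- by move: e2; rewrite !mulr1 !mul1r [LHS]addrC => /addrI.
Qed.

Lemma mulmx_Inn A X : A \in unitmx -> A *m val (Inn A X) = val X *m A.
Proof. by move=> uA; rewrite val_Inn // -!mulmxA mulKVmx. Qed.

Lemma InnP A X Y : A \in unitmx -> A *m val Y = val X *m A -> Inn A X = Y.
Proof.
by move=> uA e; apply: val_inj; rewrite val_Inn // -mulmxA -e mulKmx.
Qed.

Lemma Inn_comp A B X : A \in unitmx -> B \in unitmx ->
  Inn A (Inn B X) = Inn (B *m A) X.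
Proof.
move=> uA uB; apply/esym/InnP; first by rewrite unitmx_mul uB.
by rewrite -mulmxA mulmx_Inn // !mulmxA mulmx_Inn.
Qed.

Lemma Inn1 X : Inn 1%:M X = X.
Proof. by apply: InnP; rewrite ?unitmx1 // mul1mx mulmx1. Qed.

Lemma Inn_invK A : A \in unitmx -> cancel (Inn (invmx A)) (Inn A).
Proof. by move=> uA X; rewrite Inn_comp ?unitmx_inv // mulVmx // Inn1. Qed.

Lemma InnK A : A \in unitmx -> cancel (Inn A) (Inn (invmx A)).
Proof. by move=> uA X; rewrite Inn_comp ?unitmx_inv // mulmxV // Inn1. Qed.

Lemma InnM A : A \in unitmx -> {morph Inn A : X Y / (X * Y)%g}.
Proof.
move=> uA X Y; apply: InnP => //.
by rewrite !SL2_valM mulmxA mulmx_Inn // -!mulmxA mulmx_Inn.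
Qed.

Lemma unitmxZ2 (c : F) A : c != 0 -> A \in unitmx -> c *: A \in unitmx.
Proof. by move=> c0 uA; rewrite unitmxZ ?unitfE. Qed.

Lemma Inn_scale (c : F) A X : c != 0 -> A \in unitmx -> Inn (c *: A) X = Inn A X.
Proof.
move=> c0 uA; apply: InnP; first exact: unitmxZ2.
by rewrite -scalemxAl mulmx_Inn // scalemxAr.
Qed.

(** [B *m invmx A] centralizes SL_2, hence is scalar. *)
Lemma Inn_inj A B : A \in unitmx -> B \in unitmx -> Inn A =1 Inn B ->
  exists2 c, c != 0 & B = c *: A.
Proof.
move=> uA uB e.
have comm X : B *m invmx A *m val X = val X *m (B *m invmx A).
  rewrite mulmxA -mulmx_Inn // -e -!mulmxA; congr (B *m _).
  by rewrite val_Inn // -!mulmxA mulmxV // mulmx1.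
have /is_scalar_mxP [c ec] : is_scalar_mx (B *m invmx A).
  by apply: mx2_comm_scalar; apply: comm.
have eB : B = c *: A by rewrite -mul_scalar_mx -ec mulmxKV.
exists c => //; apply: contraTneq uB => c0.
by rewrite eB c0 scale0r unitmxE det0 unitr0.
Qed.

Lemma iter_Inn n A X : A \in unitmx -> iter n (Inn A) X = Inn (A ^+ n) X.
Proof.
move=> uA; elim: n => [|n IHn]; first by rewrite expr0 Inn1.
by rewrite iterS IHn Inn_comp // ?exprSr // -[_ \in _]/(_ \is a GRing.unit) unitrX.
Qed.

Lemma SL2_regular_Inn A : A \in unitmx -> SL2_regular (Inn A).
Proof.
move=> uA; exists (\matrix_(i, j) \sum_(a < 2) (\sum_(b < 2)
  (invmx A i b * A a j) *: 'X_(mxvec_index b a))).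
move=> X i j; rewrite val_Inn // !mxE raddf_sum; apply: eq_bigr => a _.
rewrite raddf_sum mxE big_distrl; apply: eq_bigr => b _ /=.
by rewrite mevalZ mevalXU mxvecE mulrAC.
Qed.

Lemma SL2_algaut_Inn A : A \in unitmx -> SL2_algaut (Inn A).
Proof.
move=> uA; split; [exact: InnM | exact: SL2_regular_Inn |].
exists (Inn (invmx A)); split; [exact: InnK | exact: Inn_invK |].
by apply: SL2_regular_Inn; rewrite unitmx_inv.
Qed.

(** Restricting a regular map to a one-parameter unipotent subgroup gives such a curve, which
    reduces the study of the map to polynomials in one variable. *)
Definition polynomial_curve (c : F -> SL2 F) :=
  exists P : 'M[{poly F}]_2, forall t i j, val (c t) i j = (P i j).[t].

Lemma regular_curve f c : SL2_regular f -> polynomial_curve c ->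
  polynomial_curve (f \o c).
Proof.
move=> [P fP] [Q cQ]; exists (\matrix_(i, j) \sum_(m <- msupp (P i j))
  (P i j)@_m *: \prod_l (mxvec Q 0 l) ^+ m l) => t i j.
rewrite fP mevalE mxE horner_sum; apply: eq_bigr => m _.
rewrite hornerZ horner_prod; congr (_ * _); apply: eq_bigr => l _.
by rewrite horner_exp; case/mxvec_indexP: l => a b; rewrite !mxvecE cQ.
Qed.

Lemma upper_curve : polynomial_curve upper.
Proof.
exists (mx2 1 'X 0 1) => t i j; rewrite !mxE.
by do 2!case: ifP => _; rewrite ?hornerE.
Qed.

End InnerAutomorphisms.

(** * Algebraic automorphisms of SL_2 over K are inner *)

Section AlgebraicAutomorphisms.
Variable K : closedFieldType.
Hypothesis char_K : (2 : K) != 0.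
Implicit Types (f g : SL2 K -> SL2 K) (X : SL2 K) (s t : K).

(** [p + 1] has no root, so it is constant because K is algebraically closed. *)
Lemma horner_eq0 (p : {poly K}) : (forall t, p.[t] = 0) -> p = 0.
Proof.
move=> p0; have : size (p + 1) == 1.
  apply: contraT => /closed_rootP [x].
  by rewrite /root !hornerE p0 add0r oner_eq0.
move=> /size_poly1P [c _ e].
have ep : p = (c - 1)%:P by rewrite polyCB -e addrK.
by have := p0 0; rewrite ep hornerC => ->.
Qed.

Lemma horner_inj (p q : {poly K}) : (forall t, p.[t] = q.[t]) -> p = q.
Proof.
move=> e; apply/eqP; rewrite -subr_eq0; apply/eqP/horner_eq0 => t.
by rewrite !hornerE e subrr.
Qed.

Lemma sqrt_closed t : exists s, s ^+ 2 = t.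
Proof.
have /closed_rootP [s /rootP] : size ('X^2 - t%:P : {poly K}) != 1.
  by rewrite size_XnsubC.
by rewrite !hornerE => /subr0_eq e; exists s.
Qed.

Fact torus_subproof s : s != 0 -> \det (mx2 s 0 0 s^-1) == 1.
Proof. by move=> s0; rewrite det_mx2E mul0r subr0 divff. Qed.

(* [upper (s^2)] is conjugate to [upper 1] under the torus, so the polynomial
   [t |-> tr f(upper t)] takes the same value at every nonzero [t]. *)
Lemma tr_upper f t : {morph f : X Y / (X * Y)%g} ->
  polynomial_curve (f \o @upper K) -> \tr (val (f (upper t))) = 2.
Proof.
move=> fM [P fP].
pose p := \tr P.
have pE x : p.[x] = \tr (val (f (upper x))).
  by rewrite horner_sum; apply: eq_bigr => i _; rewrite -fP.
have p1 x : x != 0 -> p.[x] = p.[1].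
  have [s <-] := sqrt_closed x; rewrite sqrf_eq0 => s0.
  pose h := MkSL2 (torus_subproof s0).
  have e : (upper (s ^+ 2) * h)%g = (h * upper 1)%g.
    by apply: val_inj; rewrite !SL2_valM /= !mulmx2; congr mx2; field.
  have {}e : f (upper (s ^+ 2)) = (f h * f (upper 1) * (f h)^-1)%g.
    by rewrite -fM -e fM mulgK.
  rewrite !pE e !SL2_valM mxtrace_mulC -!SL2_valM.
  by rewrite mulgA mulVg mul1g.
have ep : p = p.[1]%:P.
  (* The factor ['X] takes care of the point 0, about which [p1] says nothing. The constant is then
     read off at 0, where [upper 0] is the identity. *)
  suff : 'X * (p - p.[1]%:P) = 0.
    by move/eqP; rewrite mulf_eq0 polyX_eq0 /= subr_eq0 => /eqP.
  apply: horner_eq0 => x; rewrite !hornerE.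
  have [->|x0] := eqVneq x 0; first by rewrite mul0r.
  by rewrite p1 // subrr mulr0.
have f1 : f 1%g = 1%g by apply: (mulgI (f 1%g)); rewrite -fM !mulg1.
rewrite -pE ep hornerC.
have := pE 0; rewrite ep hornerC => ->.
by rewrite upper0 f1 SL2_val1 mxtrace1 ?hornerC.
Qed.

Lemma upper_nscalar t : t != 0 -> ~~ is_scalar_mx (val (upper t)).
Proof.
move=> t0; apply/is_scalar_mxP => -[c]; rewrite scalar_mx2 /= => /mx2_inj [_ e _ _].
by rewrite e eqxx in t0.
Qed.

(** The centralizer of [upper 1] consists of the matrices [upper t] and their negatives; trace 2
    excludes the negatives. *)
Lemma SL2_comm_upper1 X : (X * upper 1)%g = (upper 1 * X)%g ->
  \tr (val X) = 2 -> X = upper (val X 0 1).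
Proof.
move=> /(congr1 val); rewrite !SL2_valM /=.
have [a [b [c [d [eX e]]]]] := SL2_mx2P X; rewrite eX.
rewrite !mulmx2 => /mx2_inj [e1 e2 _ _]; rewrite tr_mx2E => etr.
have c0 : c = 0.
  by move: e1; rewrite !mulr0 !mulr1 addr0 !mul1r -[LHS]addr0 => /addrI.
have da : a = d.
  by move: e2; rewrite !mulr1 !mul1r [LHS]addrC => /addrI.
have d1 : d = 1.
  by apply: (mulfI char_K); rewrite mulr1 mulr_natl mulr2n -{1}da etr.
by apply: val_inj; rewrite eX /= mxE /= c0 da d1.
Qed.

Lemma hom1 f : {morph f : X Y / (X * Y)%g} -> f 1%g = 1%g.
Proof. by move=> fM; apply: (mulgI (f 1%g)); rewrite -fM !mulg1. Qed.

Lemma upper_image f : {morph f : X Y / (X * Y)%g} ->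
  polynomial_curve (f \o @upper K) -> f (upper 1) = upper 1 ->
  exists q : {poly K}, forall t, f (upper t) = upper q.[t].
Proof.
move=> fM fP f1; have [P eP] := fP; exists (P 0 1) => t.
rewrite -eP; apply: SL2_comm_upper1; last exact: tr_upper.
by rewrite -f1 -!fM -!upperD addrC.
Qed.

(* A polynomial bijection of the line with polynomial inverse is affine. *)
Lemma upper_fixed f g : {morph f : X Y / (X * Y)%g} ->
  {morph g : X Y / (X * Y)%g} -> cancel f g ->
  polynomial_curve (f \o @upper K) -> polynomial_curve (g \o @upper K) ->
  f (upper 1) = upper 1 -> forall t, f (upper t) = upper t.
Proof.
move=> fM gM fK fP gP f1 t.
have g1 : g (upper 1) = upper 1 by rewrite -{1}f1 fK.
have [q fq] := upper_image fM fP f1.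
have [r gr] := upper_image gM gP g1.
have upper_inj : injective (@upper K).
  by move=> x y /(congr1 val) /mx2_inj [].
have rq : r \Po q = 'X.
  apply: horner_inj => x; rewrite horner_comp hornerX.
  by apply: upper_inj; rewrite -gr -fq fK.
(* Degrees multiply under composition, so both factors of ['X] have degree 1. *)
have sq : (size q <= 2)%N.
  have := size_comp_poly r q; rewrite rq size_polyX /= => /esym/eqP.
  by rewrite muln_eq1 => /andP [_ /eqP]; case: (size q) => [|[|[|]]].
have q0 : q.[0] = 0.
  by apply: upper_inj; rewrite -fq upper0 hom1.
have q1 : q.[1] = 1 by apply: upper_inj; rewrite -fq f1.
rewrite fq; congr upper.
have qE x : q.[x] = q`_0 + q`_1 * x.
  by rewrite (horner_coef_wide _ sq) !big_ord_recl big_ord0 /= expr0 expr1 mulr1 addr0.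
move: q0 q1; rewrite !qE mulr0 addr0 mulr1 => ->.
by rewrite !add0r => ->; rewrite mul1r.
Qed.

(** This is the matrix with rows (0, 1) and (-1, 0), written in unipotents so that its image follows
    from the action on [upper] and [lower]. *)
Definition weyl : SL2 K := (upper 1 * lower (-1) * upper 1)%g.

Lemma weyl_conj t : (weyl * upper (- t))%g = (lower t * weyl)%g.
Proof.
by apply: val_inj; rewrite !SL2_valM /= !mulmx2; congr mx2; ring.
Qed.

Lemma val_weyl_sq : val (weyl * weyl)%g = (-1)%:M.
Proof.
by rewrite !SL2_valM /= !mulmx2 scalar_mx2; congr mx2; ring.
Qed.

(** -1 is the only element of order 2: if Y in SL_2 has trace T and Y^2 = 1, Cayley-Hamilton gives T
    Y = 2, so Y is scalar. *)
Lemma hom_minus1 f X : {morph f : X Y / (X * Y)%g} -> injective f ->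
  val X = (-1)%:M -> f X = X.
Proof.
move=> fM fI eX.
have XX : (X * X)%g = 1%g.
  by apply: val_inj; rewrite SL2_valM eX -scalar_mxM mulN1r opprK.
have X1 : X != 1%g.
  apply: contra char_K => /eqP /(congr1 val); rewrite eX SL2_val1 !scalar_mx2.
  by move=> /mx2_inj [e _ _ _]; rewrite -[2]/(1 + 1) -{1}e addNr.
have fX1 : f X != 1%g by rewrite -(hom1 fM) (inj_eq fI).
have := mx2_Cayley_Hamilton (val (f X)).
rewrite -SL2_valM -fM XX (hom1 fM) SL2_val1 (eqP (SL2valP _)).
set T := \tr _ => /eqP; rewrite eq_sym subr_eq => /eqP e.
have [a [b [c [d [efX edet]]]]] := SL2_mx2P (f X).
have eT : T = a + d by rewrite /T efX tr_mx2E.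
move: e; rewrite efX scalemx2 !scalar_mx2 addmx2 => /mx2_inj [ea eb ec ed].
have T0 : T != 0.
  by apply: contra char_K => /eqP T0; rewrite -[2]/(1 + 1) -ea T0 mul0r.
have b0 : b = 0 by apply: (mulfI T0); rewrite eb addr0 mulr0.
have c0 : c = 0 by apply: (mulfI T0); rewrite ec addr0 mulr0.
have da : d = a by apply: (mulfI T0); rewrite ed ea.
have /eqP : a ^+ 2 = 1 by rewrite -edet b0 da mul0r subr0.
rewrite sqrf_eq1 => /orP [] /eqP ea1.
  case/negP: fX1; apply/eqP/val_inj.
  by rewrite efX b0 c0 da ea1 SL2_val1 scalar_mx2.
by apply: val_inj; rewrite efX eX b0 c0 da ea1 scalar_mx2.
Qed.

(* [W = f weyl] conjugates [upper (- t)] to [f (lower t)]; the line fixed by the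
   latter is spanned by the first column of [W], and conjugating by a unipotent
   moves that line to the second coordinate axis. *)
Lemma hom_fixing_upper f : {morph f : X Y / (X * Y)%g} -> injective f ->
  (forall t, f (upper t) = upper t) -> exists r, f =1 Inn (val (upper r)).
Proof.
move=> fM fI fu.
have [a [b [c [d [eW edet]]]]] := SL2_mx2P (f weyl).
have fl t : val (f (lower t)) = 
    mx2 (1 + a * c * t) (- (a ^+ 2 * t)) (c ^+ 2 * t) (1 - a * c * t).
  have -> : f (lower t) = (f weyl * upper (- t) * (f weyl)^-1)%g.
    by rewrite -fu -fM weyl_conj fM mulgK.
  rewrite !SL2_valM -[val ((f weyl)^-1)%g]/(invmx (val (f weyl))) eW.
  rewrite invmx2 edet ?oner_eq0 //.
  rewrite invr1 scale1r /= !mulmx2.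
  by rewrite -[in RHS]edet; congr mx2; ring.
(* Otherwise [f (lower 1)] would be an upper unitriangular matrix, which is already the image of
   itself. *)
have c0 : c != 0.
  apply: contraTneq isT => c0.
  have /fI /(congr1 val) /= /mx2_inj [_ _ /eqP] : f (lower 1) = f (upper (- a ^+ 2)).
    apply: val_inj; rewrite fl fu /= c0.
    by congr mx2; ring.
  by rewrite oner_eq0.
pose r := a / c.
have uV s : val (upper s) \in unitmx by exact: SL2_unitmx.
pose h X := Inn (val (upper r)) (f X).
have hM : {morph h : X Y / (X * Y)%g} by move=> X Y; rewrite /h fM InnM.
have hI : injective h by move=> X Y /(can_inj (InnK (uV r))) /fI.
have hu t : h (upper t) = upper t.
  apply: InnP => //; rewrite fu -!SL2_valM -!upperD addrC //.
have hl t : h (lower t) = lower (c ^+ 2 * t).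
  apply: InnP => //; rewrite fl /= !mulmx2 /r.
  by congr mx2; field.
have hw : h weyl = (upper 1 * lower (- c ^+ 2) * upper 1)%g.
  by rewrite /weyl !hM !hu hl mulrN1.
(* With x = c^2, the lower left entry of the square of [h weyl] is -2 x (1 - x), and it must vanish
   since that square is -1. *)
have c21 : c ^+ 2 = 1.
  have := congr1 val (hom_minus1 hM hI val_weyl_sq).
  rewrite val_weyl_sq hM hw !SL2_valM /= !mulmx2 scalar_mx2.
  have := expf_neq0 2 c0; move: (c ^+ 2) => x x0 /mx2_inj [_ _ /eqP e _].
  have : 2 * x * (1 - x) == 0 by rewrite -oppr_eq0 -(eqP e); apply/eqP; ring.
  by rewrite !mulf_eq0 (negPf char_K) (negPf x0) /= subr_eq0 eq_sym => /eqP.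
have hid : h =1 id.
  by apply: upper_lower_gen => // t; rewrite hl c21 mul1r.
exists (- r) => X.
rewrite -[in RHS](hid X) /h Inn_comp //.
have -> : val (upper r) *m val (upper (- r)) = 1%:M.
  by rewrite -SL2_valM -upperD addrN upper0.
by rewrite Inn1.
Qed.

Lemma SL2_algaut_inner f : SL2_algaut f ->
  exists2 A, A \in unitmx & f =1 Inn A.
Proof.
move=> [fM fR [g [fK gK gR]]].
have gM : {morph g : X Y / (X * Y)%g}.
  by move=> X Y; apply: (can_inj fK); rewrite fM !gK.
have f1 : f (upper 1) != 1%g.
  rewrite -(hom1 fM) (inj_eq (can_inj fK)); apply/negP => /eqP /(congr1 val).
  move=> e; have := upper_nscalar (oner_neq0 K).
  by rewrite e SL2_val1 scalar_mx_is_scalar.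
(* A scalar matrix of trace 2 is the identity. Being nonscalar with the right trace and determinant,
   [f (upper 1)] is then similar to [upper 1]. *)
have fns : ~~ is_scalar_mx (val (f (upper 1))).
  apply: contra f1 => /is_scalar_mxP [x ex].
  have := tr_upper 1 fM (regular_curve fR (@upper_curve K)).
  rewrite ex mxtrace_scalar -[x *+ 2]mulr_natl -[RHS]mulr1 => /(mulfI char_K) x1.
  by apply/eqP/val_inj; rewrite ex x1.
have [B uB eB] : exists2 B, B \in unitmx & val (f (upper 1)) *m B = B *m val (upper 1).
  apply: similar2 => //; first exact: upper_nscalar (oner_neq0 K).
    by rewrite (tr_upper 1 fM (regular_curve fR (@upper_curve K))) tr_mx2E.
  by rewrite !(eqP (SL2valP _)).
pose f' X := Inn B (f X); pose g' X := g (Inn (invmx B) X).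
have uB' : invmx B \in unitmx by rewrite unitmx_inv.
have f'M : {morph f' : X Y / (X * Y)%g} by move=> X Y; rewrite /f' fM InnM.
have g'M : {morph g' : X Y / (X * Y)%g} by move=> X Y; rewrite /g' InnM // gM.
have f'K : cancel f' g' by move=> X; rewrite /g' /f' InnK.
have f'u : forall t, f' (upper t) = upper t.
  apply: (upper_fixed f'M g'M f'K); last exact: InnP.
    by apply: (regular_curve (SL2_regular_Inn uB));
      apply: regular_curve fR _; apply: upper_curve.
  by apply: (regular_curve gR);
    apply: regular_curve (SL2_regular_Inn uB') _; apply: upper_curve.
have [r f'r] := hom_fixing_upper f'M (can_inj f'K) f'u.
exists (val (upper r) *m invmx B); first by rewrite unitmx_mul SL2_unitmx.
by move=> X; rewrite -Inn_comp ?SL2_unitmx // -f'r InnK.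
Qed.

End AlgebraicAutomorphisms.

(** * Order and conjugacy in PGL(2,k) through trace and determinant *)

Section ProjectiveConjugacy.
Variable k : fieldType.
Implicit Types (A B Q : 'M[k]_2).

Definition proj_order A m :=
  [/\ (0 < m)%N, is_scalar_mx (A ^+ m) &
      forall n, (0 < n < m)%N -> ~~ is_scalar_mx (A ^+ n)].

Definition proj_conj A B := exists Q c,
  [/\ Q \in unitmx, c != 0 & B *m Q = c *: (Q *m A)].

Lemma proj_order_nscalar A m : (1 < m)%N -> proj_order A m -> ~~ is_scalar_mx A.
Proof. by move=> m1 [_ _ /(_ 1)]; rewrite expr1; apply. Qed.

Lemma nscalarZ c A : c != 0 -> ~~ is_scalar_mx A -> ~~ is_scalar_mx (c *: A).
Proof.
move=> c0; apply: contra => /is_scalar_mxP [x e]; apply/is_scalar_mxP.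
exists (c^-1 * x); rewrite -[LHS]scale1r -(mulVf c0) -scalerA e.
by rewrite scale_scalar_mx.
Qed.

(** Trace and determinant classify nonscalar matrices up to similarity, and scaling by c multiplies
    them by c and c^2. *)
Lemma proj_conjP A B : ~~ is_scalar_mx A -> ~~ is_scalar_mx B ->
  proj_conj A B <->
  exists c, [/\ c != 0, \tr B = c * \tr A & \det B = c ^+ 2 * \det A].
Proof.
move=> nA nB; split.
- move=> [Q [c [uQ c0 e]]]; exists c; split => //.
    by rewrite -[B](mulmxK uQ) e -scalemxAl mxtraceZ mxtrace_mulC mulKmx.
  have /(congr1 determinant) := e; rewrite detZ !det_mulmx => e'.
  have dQ : \det Q != 0 by rewrite -unitfE -unitmxE.
  by apply: (mulIf dQ); rewrite e'; ring.
- move=> [c [c0 et ed]].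
  have [Q uQ e] : exists2 Q, Q \in unitmx & B *m Q = Q *m (c *: A).
    by apply: similar2 => //; rewrite ?nscalarZ // ?mxtraceZ // detZ.
  by exists Q, c; split => //; rewrite e scalemxAr.
Qed.

Fixpoint lucas (R : comNzRingType) (t d : R) n : R :=
  if n is n'.+1 then
    if n' is n''.+1 then t * lucas t d n' - d * lucas t d n'' else 1
  else 0.

Lemma lucasSS (R : comNzRingType) (t d : R) n :
  lucas t d n.+2 = t * lucas t d n.+1 - d * lucas t d n.
Proof. by []. Qed.

(** Each multiplication by A is reduced by Cayley-Hamilton, which is the Lucas recurrence on the
    coefficient of A. *)
Lemma mx2_exp A n :
  A ^+ n.+1 = lucas (\tr A) (\det A) n.+1 *: A -
    (\det A * lucas (\tr A) (\det A) n)%:M.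
Proof.
elim: n => [|n IHn].
  by rewrite expr1 /= scale1r mulr0 raddf0 subr0.
rewrite exprSr IHn lucasSS -mulmxE mulmxBl -scalemxAl mx2_Cayley_Hamilton.
rewrite mul_scalar_mx scalerBr scalerA scale_scalar_mx scalerBl.
rewrite [RHS]addrAC mulrC -[LHS]addrA -[RHS]addrA; congr (_ + _).
by rewrite [_ * \det A]mulrC.
Qed.

Lemma mx2_exp_scalar A n : ~~ is_scalar_mx A ->
  is_scalar_mx (A ^+ n) = (lucas (\tr A) (\det A) n == 0).
Proof.
move=> nA; case: n => [|n].
  by rewrite expr0 eqxx scalar_mx_is_scalar.
rewrite mx2_exp; set u := lucas _ _ n.+1.
have [->|u0] := eqVneq u 0.
  by rewrite scale0r sub0r -raddfN scalar_mx_is_scalar.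
apply: contraNF nA => /is_scalar_mxP [x /eqP]; rewrite subr_eq -raddfD.
move=> /eqP e; apply: contraTT isT => nA.
have := nscalarZ u0 nA.
by rewrite e scalar_mx_is_scalar.
Qed.

(** The n-th term is homogeneous of weight n - 1; the extra factor c on the left avoids that
    exponent at n = 0. *)
Lemma lucas_scale (c t d : k) n :
  c * lucas (c * t) (c ^+ 2 * d) n = c ^+ n * lucas t d n.
Proof.
(* The recurrence has depth two, so the induction carries two consecutive terms. *)
suff [//] : c * lucas (c * t) (c ^+ 2 * d) n = c ^+ n * lucas t d n /\
  c * lucas (c * t) (c ^+ 2 * d) n.+1 = c ^+ n.+1 * lucas t d n.+1.
elim: n => [|n [IH0 IH1]]; first by rewrite /= expr1 !mulr0.
split=> //; rewrite !lucasSS.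
rewrite mulrBr ![c * (_ * _)]mulrCA IH1 IH0 !exprS; ring.
Qed.

Definition lucas_order (t d : k) m :=
  [/\ (0 < m)%N, lucas t d m = 0 & forall n, (0 < n < m)%N -> lucas t d n != 0].

Lemma proj_orderP A m : ~~ is_scalar_mx A ->
  proj_order A m <-> lucas_order (\tr A) (\det A) m.
Proof.
move=> nA; split=> -[m0 e h]; split=> //.
- by apply/eqP; rewrite -mx2_exp_scalar.
- by move=> n /h; rewrite mx2_exp_scalar.
- by rewrite mx2_exp_scalar //; apply/eqP.
- by move=> n /h; rewrite mx2_exp_scalar.
Qed.

Lemma companion2_nscalar (t d : k) : ~~ is_scalar_mx (companion2 t d).
Proof.
apply/is_scalar_mxP => -[c]; rewrite scalar_mx2 => /mx2_inj [_ _ /eqP].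
by rewrite oner_eq0.
Qed.

Lemma tr_companion2 (t d : k) : \tr (companion2 t d) = t.
Proof. by rewrite tr_mx2E add0r. Qed.

Lemma det_companion2 (t d : k) : \det (companion2 t d) = d.
Proof. by rewrite det_mx2E mul0r sub0r mulr1 opprK. Qed.

Lemma companion2_unit (t d : k) : (companion2 t d \in unitmx) = (d != 0).
Proof. by rewrite unitmxE det_companion2 unitfE. Qed.

End ProjectiveConjugacy.

(** * Descent from K to k, and isomorphy classes as classes of PGL(2,k) *)

Section RationalAutomorphisms.
Variables (k : fieldType) (K : closedFieldType) (iota : {rmorphism k -> K}).
Hypothesis char_k : 2%N \notin [pchar k].
Implicit Types (A B Q : 'M[k]_2) (theta tau : SL2 K -> SL2 K).
Local Notation "A ^i" := (map_mx iota A) (at level 2, format "A ^i").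

Lemma two_neq0 : (2 : K) != 0.
Proof. by have := char_k; rewrite -(fmorph_pchar iota) inE. Qed.

Lemma map_Inn A (Y : SL2 k) (X : SL2 K) : A \in unitmx ->
  (val Y)^i = val X -> (val (Inn A Y))^i = val (Inn A^i X).
Proof.
by move=> uA e; rewrite !val_Inn ?map_unitmx // !map_mxM map_invmx e.
Qed.

Lemma kaut_Inn A : A \in unitmx -> kaut iota (Inn A^i).
Proof.
move=> uA; have uAi : A^i \in unitmx by rewrite map_unitmx.
split; first exact: SL2_algaut_Inn.
apply/seteqP; split => [_ [X [Y eY] <-]|X [Y eY]].
  by exists (Inn A Y); apply: map_Inn.
exists (Inn (invmx A^i) X); last exact: Inn_invK.
exists (Inn (invmx A) Y); rewrite -map_invmx; apply: map_Inn => //.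
by rewrite unitmx_inv.
Qed.

Lemma Inn_rational (A : 'M[K]_2) : A \in unitmx ->
  (forall X, SL2_rational iota X -> SL2_rational iota (Inn A X)) ->
  exists2 B, B \in unitmx & Inn A =1 Inn B^i.
Proof.
move=> uA rA.
suff [x [B [x0 eB]]] : exists x B, x != 0 /\ B^i = x *: A.
  exists B; first by rewrite -(map_unitmx iota) eB unitmxZ2.
  by move=> X; rewrite eB Inn_scale.
have [Y eY] : exists Y : SL2 k, (val Y)^i = val (Inn A (upper 1)).
  by apply: rA; exists (upper 1); rewrite /= map_mx2 rmorph1 rmorph0.
have [Z eZ] : exists Z : SL2 k, (val Z)^i = val (Inn A (lower 1)).
  by apply: rA; exists (lower 1); rewrite /= map_mx2 rmorph1 rmorph0.
move: eY eZ; rewrite !val_Inn //; move: uA.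
have [a [b [c [d ->]]]] : exists a b c d, A = mx2 a b c d.
  by do 4!eexists; exact: mx2E.
rewrite unitmxE det_mx2E unitfE => D0; rewrite invmx2 // -!scalemxAl.
rewrite (mx2E (val Y)) (mx2E (val Z)) !map_mx2 /= !mulmx2 !scalemx2.
move: (val Y 0 0) (val Y 0 1) (val Y 1 0) (val Y 1 1) => e0 e1 e2 e3.
move: (val Z 0 0) (val Z 0 1) (val Z 1 0) (val Z 1 1) => f0 f1 f2 f3.
set D := a * d - b * c in D0 *.
move=> /mx2_inj [E0 E1 E2 E3] /mx2_inj [F0 F1 F2 F3].
(* Up to sign, the entries of Y - 1 and Z - 1 are the products of two entries of one row of A, over
   D. The mixed products needed for the second row of (a / D) A come from multiplying its first row
   by Y - 1, since a d - b c = D. If a = 0, b takes its place. *)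
have [a0|a0] := eqVneq a 0; last first.
  exists (a / D), (mx2 f2 (f3 - 1) (f2 * (e0 - 1) + (f3 - 1) * e2)
                           (f2 * e1 + (f3 - 1) * (e3 - 1))).
  split; first by rewrite mulf_neq0 // invr_eq0.
  rewrite map_mx2 scalemx2 !(rmorphB, rmorphD, rmorphM, rmorph1) E0 E1 E2 E3 F2 F3.
  by congr mx2; rewrite /D; field.
have b0 : b != 0.
  by apply: contraNneq D0 => b0; rewrite /D a0 b0 !mul0r subr0.
exists (b / D), (mx2 (f3 - 1) (- f1) (- ((f0 - 1) * (e0 - 1) + f1 * e2))
                           (- ((f0 - 1) * e1 + f1 * (e3 - 1)))).
split; first by rewrite mulf_neq0 // invr_eq0.
rewrite map_mx2 scalemx2 !(rmorphN, rmorphB, rmorphD, rmorphM, rmorph1).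
rewrite E0 E1 E2 E3 F0 F1 F3.
by congr mx2; rewrite /D; field.
Qed.

Lemma kautP theta : kaut iota theta <->
  exists2 A, A \in unitmx & theta = Inn A^i.
Proof.
split=> [[/(SL2_algaut_inner two_neq0) [A uA e] r]|[A uA ->]]; last exact: kaut_Inn.
have [|B uB eB] := Inn_rational uA.
  by move=> X rX; rewrite -r; exists X; rewrite ?e.
by exists B => //; apply/funext => X; rewrite e eB.
Qed.

Lemma Inn_map_eq A B : A \in unitmx -> B \in unitmx ->
  Inn A^i = Inn B^i <-> exists2 c, c != 0 & B = c *: A.
Proof.
move=> uA uB; split => [e|[c c0 ->]]; last first.
  by apply/funext => X; rewrite map_mxZ Inn_scale ?map_unitmx // fmorph_eq0.
have [|||c c0 ec] := @Inn_inj _ A^i B^i; rewrite ?map_unitmx // ?e //.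
(* The factor c lies in K only; being scalar descends along [iota] and yields a factor in k. *)
have : is_scalar_mx (B *m invmx A).
  rewrite -(map_mx_is_scalar iota) map_mxM map_invmx ec -scalemxAl.
  rewrite mulmxV ?map_unitmx //.
  by rewrite -mul_scalar_mx mulmx1 scalar_mx_is_scalar.
move=> /is_scalar_mxP [x ex].
have eB : B = x *: A by rewrite -mul_scalar_mx -ex mulmxKV.
exists x => //; apply: contraTneq uB => x0.
by rewrite eB x0 scale0r unitmxE det0 unitr0.
Qed.

Lemma Inn_map_id A : A \in unitmx ->
  (Inn A^i =1 id) <-> is_scalar_mx A.
Proof.
move=> uA; have u1 : 1%:M \in @unitmx k 2 by rewrite unitmx1.
have id1 : (id : SL2 K -> SL2 K) = Inn (1%:M)^i.
  by apply/funext => X; rewrite map_mx1 Inn1.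
split=> [/funext|/is_scalar_mxP [x ex]].
  rewrite id1 => /esym /(Inn_map_eq u1 uA) [c _ ->].
  by rewrite -mul_scalar_mx mulmx1 scalar_mx_is_scalar.
have eA : A = x *: 1%:M by rewrite -mul_scalar_mx mulmx1.
move=> X; have /(Inn_map_eq u1 uA) <- : exists2 c, c != 0 & A = c *: 1%:M.
  exists x => //; apply: contraTneq uA => x0.
  by rewrite eA x0 scale0r unitmxE det0 unitr0.
by rewrite -id1.
Qed.

Lemma has_order_Inn A m : A \in unitmx ->
  has_order (Inn A^i) m <-> proj_order A m.
Proof.
move=> uA.
have itE n : (iter n (Inn A^i) =1 id) <-> is_scalar_mx (A ^+ n).
  have uAn : A ^+ n \in unitmx by rewrite -[_ \in _]/(_ \is a GRing.unit) unitrX.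
  rewrite -(Inn_map_id uAn) (rmorphXn (map_mx iota)).
  by split=> h X; move: (h X); rewrite iter_Inn ?map_unitmx.
split=> -[m0 /itE e h]; split=> //.
- by move=> n /h ne; apply/negP => /itE.
- by move=> n /h /negP ne /itE.
Qed.

Lemma isomorphic_Inn A B : A \in unitmx -> B \in unitmx ->
  isomorphic iota (Inn A^i) (Inn B^i) <-> proj_conj A B.
Proof.
move=> uA uB.
have conjE Q : Q \in unitmx ->
  Inn (invmx Q^i) \o Inn A^i \o Inn Q^i = Inn (Q *m A *m invmx Q)^i.
  move=> uQ; apply/funext => X /=.
  by rewrite !Inn_comp ?unitmx_mul ?unitmx_inv ?map_unitmx ?uA //
    !map_mxM map_invmx mulmxA.
have uC Q : Q \in unitmx -> Q *m A *m invmx Q \in unitmx.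
  by move=> uQ; rewrite !unitmx_mul unitmx_inv uQ uA.
split=> [[Q uQ]|[Q [c [uQ c0 e]]]].
  rewrite conjE // => /esym /(Inn_map_eq (uC Q uQ) uB) [c c0 eB].
  by exists Q, c; split=> //; rewrite eB -scalemxAl mulmxKV.
exists Q => //; rewrite conjE //; apply/esym/(Inn_map_eq (uC Q uQ) uB).
by exists c => //; rewrite scalemxAl -e mulmxK.
Qed.

Lemma isomorphic_sym theta tau :
  isomorphic iota theta tau -> isomorphic iota tau theta.
Proof.
move=> [Q uQ ->]; exists (invmx Q); first by rewrite unitmx_inv.
apply/funext => X /=; rewrite map_invmx invmxK.
by rewrite !Inn_invK ?map_unitmx.
Qed.

Lemma isomorphic_trans theta tau rho : isomorphic iota theta tau ->
  isomorphic iota tau rho -> isomorphic iota theta rho.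
Proof.
move=> [Q uQ ->] [P uP ->]; exists (P *m Q); first by rewrite unitmx_mul uP.
apply/funext => X /=; rewrite map_mxM.
have uPi : P^i \in unitmx by rewrite map_unitmx.
have uQi : Q^i \in unitmx by rewrite map_unitmx.
have uPQ : P^i *m Q^i \in unitmx by rewrite unitmx_mul uPi.
by apply: (can_inj (InnK uPQ)); rewrite Inn_invK // -!Inn_comp // !Inn_invK.
Qed.

Definition isomorphy_class theta :=
  [set tau | kaut iota tau /\ isomorphic iota theta tau].

Lemma eq_isomorphy_class A B : A \in unitmx -> B \in unitmx ->
  isomorphy_class (Inn A^i) = isomorphy_class (Inn B^i) <-> proj_conj A B.
Proof.
move=> uA uB; split=> [e|/(isomorphic_Inn uA uB) e].
  apply/(isomorphic_Inn uA uB).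
  have : isomorphy_class (Inn B^i) (Inn B^i).
    split; [exact: kaut_Inn | exists 1%:M; first by rewrite unitmx1].
    by apply/funext => X /=; rewrite map_mx1 invmx1 !Inn1.
  by rewrite -e => -[].
apply/seteqP; split=> tau [ktau i]; split=> //.
  exact: isomorphic_trans (isomorphic_sym e) i.
exact: isomorphic_trans e i.
Qed.

(** Turns the count into one of parameters: every class has a representative [M x], and
    [eq_isomorphy_class] decides when two parameters give the same class. *)
Lemma isomorphy_classes_image m (T : Type) (D : set T) (M : T -> 'M[k]_2) :
  (forall x, D x -> M x \in unitmx /\ proj_order (M x) m) ->
  (forall A, A \in unitmx -> proj_order A m -> exists2 x, D x & proj_conj (M x) A) ->
  isomorphy_classes iota m = (fun x => isomorphy_class (Inn (M x)^i)) @` D.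
Proof.
move=> DM Dsur; apply/seteqP; split=> [C [theta [/kautP [A uA ->]]]|C [x Dx <-]].
  move=> /(has_order_Inn _ uA) oA ->.
  have [x Dx xA] := Dsur A uA oA; exists x => //.
  by have [uM _] := DM x Dx; apply/(eq_isomorphy_class uM uA).
have [uM oM] := DM x Dx; exists (Inn (M x)^i); split => //.
  exact: kaut_Inn.
exact/(has_order_Inn _ uM).
Qed.

End RationalAutomorphisms.

(** * Half of the totient, and primitive roots of unity *)

Lemma coprime_subr m j : (j <= m)%N -> coprime m (m - j) = coprime m j.
Proof.
move=> jm; have := subnK jm; move: (m - j)%N => i <-.
by rewrite ![coprime (i + j) _]coprime_sym /coprime gcdnDl gcdnDr gcdnC.
Qed.

Lemma coprime_double_neq m j : (2 < m)%N -> coprime m j -> j.*2 != m.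
Proof.
move=> m2; apply: contraTneq => jm2; rewrite /coprime -jm2 -muln2 gcdnC gcdnMr.
by apply/eqP => e; lia.
Qed.

(** The involution j -> m - j exchanges the residues prime to m below m / 2 with those above; m / 2
    itself is never prime to m > 2. *)
Lemma totient_half m : (2 < m)%N ->
  (totient m)./2 = size [seq j <- iota 0 m | coprime m j && (j.*2 < m)%N].
Proof.
move=> m2; pose lo j : nat := coprime m j && (j.*2 < m)%N.
have -> : size [seq j <- iota 0 m | coprime m j && (j.*2 < m)%N] =
  \sum_(0 <= j < m) lo j.
  rewrite size_filter -sum1_count big_mkcond /index_iota subn0.
  by apply: eq_bigr => j _; rewrite /lo; case: ifP.
have m0 : (0 < m)%N by apply: leq_trans m2.
have copr0 : coprime m 0 = false.
  by rewrite /coprime gcdn0; case: m m2 {lo m0} => [|[|]].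
rewrite totient_count_coprime !(big_ltn m0) {1}/lo copr0 /= !add0n.
have -> : (\sum_(1 <= j < m) coprime m j =
  \sum_(1 <= j < m) lo j + \sum_(1 <= j < m) lo (m - j))%N.
  rewrite -big_split /=; apply: eq_big_nat => j /andP [j1 jm].
  rewrite /lo (coprime_subr (ltnW jm)); case cm: (coprime m j) => //=.
  have := coprime_double_neq m2 cm.
  by lia.
have -> : (\sum_(1 <= j < m) lo (m - j) = \sum_(1 <= j < m) lo j)%N.
  rewrite big_nat_rev; apply: eq_big_nat => j /andP [j1 jm].
  by congr lo; lia.
by rewrite addnn doubleK.
Qed.

(** Gives primitivity the same shape as [lucas_order]: a first vanishing index. *)
Lemma primitive_rootP (R : nzRingType) m (z : R) :
  reflect [/\ (0 < m)%N, z ^+ m = 1 & forall n, (0 < n < m)%N -> z ^+ n != 1]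
    (m.-primitive_root z).
Proof.
apply: (iffP idP) => [pz|[m0 zm h]].
  split; [exact: prim_order_gt0 pz | exact: prim_expr_order |].
  move=> n /andP [n0 nm]; rewrite -(prim_order_dvd pz).
  by apply/negP => /(dvdn_leq n0); rewrite leqNgt nm.
have [n pn nm] := prim_order_exists m0 zm.
have [e|nem] := eqVneq n m; first by rewrite -e.
have := h n; rewrite (prim_order_gt0 pn) ltn_neqAle nem (dvdn_leq m0 nm).
by rewrite (prim_expr_order pn) eqxx => /(_ isT).
Qed.

(** * Closed forms of the Lucas sequence *)

Section Lucas.
Variable R : comNzRingType.
Implicit Types a b : R.

(** Binet's formula with the division cleared. *)
Lemma lucas_roots a b n : (a - b) * lucas (a + b) (a * b) n = a ^+ n - b ^+ n.
Proof.
suff [] : (a - b) * lucas (a + b) (a * b) n = a ^+ n - b ^+ n /\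
  (a - b) * lucas (a + b) (a * b) n.+1 = a ^+ n.+1 - b ^+ n.+1 by [].
elim: n => [|n [IH0 IH1]]; first by rewrite /= mulr0 mulr1 subrr.
split=> //; rewrite lucasSS mulrBr ![(a - b) * (_ * _)]mulrCA IH1 IH0 !exprS.
by ring.
Qed.

Lemma lucas_double_root a n : lucas (a + a) (a * a) n.+1 = n.+1%:R * a ^+ n.
Proof.
suff [] : lucas (a + a) (a * a) n.+1 = n.+1%:R * a ^+ n /\
  lucas (a + a) (a * a) n.+2 = n.+2%:R * a ^+ n.+1 by [].
elim: n => [|n [IH0 IH1]]; first by rewrite /= expr0 expr1; split; ring.
by split=> //; rewrite lucasSS IH1 IH0 !exprS; ring.
Qed.

Lemma lucas_map (S : comNzRingType) (f : {rmorphism R -> S}) t d n :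
  f (lucas t d n) = lucas (f t) (f d) n.
Proof.
suff [] : f (lucas t d n) = lucas (f t) (f d) n /\
  f (lucas t d n.+1) = lucas (f t) (f d) n.+1 by [].
elim: n => [|n [IH0 IH1]]; first by rewrite /= rmorph0 rmorph1.
by split=> //; rewrite !lucasSS rmorphB !rmorphM IH0 IH1.
Qed.

End Lucas.

(** * Counting the determinants of trace 1 matrices of given projective order *)

Section Counting.
Variables (k : fieldType) (K : closedFieldType) (iota : {rmorphism k -> K}).

(** By Binet's formula the n-th term vanishes exactly when x^n = y^n. *)
Lemma lucas_order_primitive (d : k) (x y : K) m :
  x + y = 1 -> x * y = iota d -> x != y -> y != 0 ->
  lucas_order 1 d m <-> m.-primitive_root (x / y).
Proof.
move=> exy dxy nxy y0.
have lucas0 n : (lucas 1 d n == 0) = ((x / y) ^+ n == 1).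
  rewrite -(fmorph_eq0 iota) lucas_map rmorph1 -exy -dxy.
  rewrite -(mulrI_eq0 _ (mulfI (_ : x - y != 0))) ?subr_eq0 // lucas_roots subr_eq0.
  rewrite expr_div_n -[RHS](inj_eq (mulIf (expf_neq0 n y0))) divfK ?expf_neq0 //.
  by rewrite exy mul1r.
split=> [[m0 e h]|/primitive_rootP [m0 e h]].
  apply/primitive_rootP; split=> //; first by apply/eqP; rewrite -lucas0 e.
  by move=> n /h; rewrite lucas0.
split=> //; first by apply/eqP; rewrite lucas0 e.
by move=> n /h; rewrite lucas0.
Qed.

Lemma quadratic_roots (d : k) : exists x y : K, x + y = 1 /\ x * y = iota d.
Proof.
have s2 : (size ((iota d)%:P - 'X)%R < size ('X^2 : {poly K})%R)%N.
  rewrite size_polyXn; apply: leq_ltn_trans (size_polyD _ _) _.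
  by rewrite size_polyN size_polyX gtn_max size_polyC; case: (_ == _).
have /closed_rootP [x /rootP] : size ('X^2 + ((iota d)%:P - 'X) : {poly K}) != 1.
  by rewrite size_polyDl // size_polyXn.
rewrite !(hornerD, hornerN, hornerXn, hornerC, hornerX) => e.
exists x, (1 - x); split; first by rewrite addrC subrK.
by apply/eqP; rewrite -subr_eq0 -oppr_eq0; apply/eqP; rewrite -[RHS]e; ring.
Qed.

(* A double root [x] gives [lucas 1 d n = n x^(n-1)], whose first zero is the
   characteristic. *)
Lemma lucas_order_separable (d : k) (x y : K) m : m \notin [pchar k] ->
  d != 0 -> lucas_order 1 d m -> x + y = 1 -> x * y = iota d -> x != y.
Proof.
move=> mk d0 [m0 em h] exy dxy; apply: contraNneq mk => xy.
rewrite -{}xy in exy dxy.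
have x0 : x != 0.
  by apply: contra d0 => /eqP x0; rewrite -(fmorph_eq0 iota) -dxy x0 mulr0.
have lucas0 n : (0 < n)%N -> (lucas 1 d n == 0) = (n%:R == 0 :> K).
  case: n => // n _; rewrite -(fmorph_eq0 iota) lucas_map rmorph1 -exy -dxy.
  by rewrite lucas_double_root mulf_eq0 expf_eq0 (negPf x0) andbF orbF exy.
have mK : m%:R == 0 :> K by rewrite -lucas0 // em.
have [p pK] := natf0_pchar m0 mK.
have pm : (p <= m)%N by apply: dvdn_leq => //; rewrite (dvdn_pcharf pK).
have p0 : (0 < p)%N by rewrite prime_gt0 // (pcharf_prime pK).
rewrite -(fmorph_pchar iota).
have [->//|pnm] := eqVneq m p.
have := h p; rewrite p0 ltn_neqAle eq_sym pnm pm => /(_ isT).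
by rewrite lucas0 // (pcharf0 pK) eqxx.
Qed.

(* [x y / (x + y)^2] as a function of [x / y] is invariant under inversion
   and two-to-one. *)
Definition ratio_inv (z : K) := z / (1 + z) ^+ 2.

Lemma ratio_invE (x y : K) : y != 0 -> x + y = 1 -> x * y = ratio_inv (x / y).
Proof.
move=> y0 e; rewrite /ratio_inv.
have ex : 1 + x / y = y^-1 by rewrite -{1}(divff y0) -mulrDl addrC e mul1r.
by rewrite ex; field; rewrite y0 oner_neq0.
Qed.

Lemma ratio_inv_eq (z w : K) : 1 + z != 0 -> 1 + w != 0 ->
  ratio_inv z = ratio_inv w -> z = w \/ z * w = 1.
Proof.
move=> z1 w1 /eqP; rewrite eqr_div ?expf_neq0 // => /eqP e.
have : (z - w) * (1 - z * w) == 0.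
  apply/eqP; transitivity (z * (1 + w) ^+ 2 - w * (1 + z) ^+ 2); first by ring.
  by rewrite e subrr.
by rewrite mulf_eq0 !subr_eq0 => /orP [] /eqP; [left | right].
Qed.

Lemma ratio_invV (z : K) : z != 0 -> 1 + z != 0 -> ratio_inv z^-1 = ratio_inv z.
Proof.
move=> z0 z1; rewrite /ratio_inv; field.
by rewrite z0 z1.
Qed.

(** If z^j = -1, then m divides 2 j, hence 2. *)
Lemma prim_root_neqN1 m (z : K) j : (2 < m)%N -> m.-primitive_root z ->
  coprime m j -> 1 + z ^+ j != 0.
Proof.
move=> m2 pz cj; rewrite addrC addr_eq0; apply/negP => /eqP e.
have : (m %| j * 2)%N by rewrite (prim_order_dvd pz) exprM e sqrrN expr1n.
by rewrite Gauss_dvdr // => /dvdn_leq; lia.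
Qed.

Definition lucas_params m : set k := [set d | d != 0 /\ lucas_order 1 d m].

(** A single parameter d0 supplies a primitive root a / b, and its powers of exponent prime to m are
    all the eigenvalue ratios that can occur. *)
Lemma lucas_paramsE (d0 : k) (m : nat) (a b : K) : (2 < m)%N -> m \notin [pchar k] ->
  a + b = 1 -> a * b = iota d0 -> d0 != 0 -> m.-primitive_root (a / b) ->
  forall d, lucas_params m d <->
    exists2 j, (j < m)%N && coprime m j & iota d = ratio_inv ((a / b) ^+ j).
Proof.
move=> m2 mk ab1 abd d00 pz d; set z := a / b in pz *.
have b0 : b != 0.
  by apply: contra d00 => /eqP b0; rewrite -(fmorph_eq0 iota) -abd b0 mulr0.
split=> [[dn0 od]|[j /andP [jm cj] ej]].
  have [x [y [xy1 xyd]]] := quadratic_roots d.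
  have nxy := lucas_order_separable mk dn0 od xy1 xyd.
  have y0 : y != 0.
    by apply: contra dn0 => /eqP y0; rewrite -(fmorph_eq0 iota) -xyd y0 mulr0.
  have pxy := proj1 (lucas_order_primitive m xy1 xyd nxy y0) od.
  have [[j jm] /= ej] := prim_rootP pz (prim_expr_order pxy).
  exists j; last by rewrite -ej -xyd ratio_invE.
  by rewrite jm coprime_sym -(prim_root_exp_coprime j pz) -ej.
have zj1 := prim_root_neqN1 m2 pz cj.
have pzj : m.-primitive_root (z ^+ j) by rewrite prim_root_exp_coprime // coprime_sym.
(* The pair with sum 1 and ratio [z ^+ j]. *)
pose x := z ^+ j / (1 + z ^+ j); pose y := (1 + z ^+ j)^-1.
have y0 : y != 0 by rewrite invr_eq0.
have zj0 : z ^+ j != 0.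
  by rewrite (prim_root_eq0 pzj) -lt0n; lia.
have xyz : x / y = z ^+ j by rewrite /x /y invrK divfK.
have nxy : x != y.
  apply/negP => /eqP e; move: xyz; rewrite e divff // => /esym zj.
  by have /primitive_rootP [_ _ /(_ 1)] := pzj; rewrite expr1 zj eqxx; lia.
have exy : x + y = 1 by rewrite /x /y; field.
have dxy : x * y = iota d by rewrite ej ratio_invE // xyz.
split; first by rewrite -(fmorph_eq0 iota) -dxy mulf_neq0 // /x mulf_neq0.
by apply/(lucas_order_primitive m exy dxy nxy y0); rewrite xyz.
Qed.

(* [a^j + b^j] lies in [k] because [a + b] and [a b] do. *)
Lemma ratio_inv_rational (d0 : k) (a b : K) j : a + b = 1 -> a * b = iota d0 ->
  a != b -> b != 0 -> 1 + (a / b) ^+ j != 0 ->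
  exists d, iota d = ratio_inv ((a / b) ^+ j).
Proof.
move=> ab1 abd nab b0 zj.
(* The companion Lucas sequence V_j = 2 U_(j+1) - t U_j at t = 1. *)
pose v := 2 * lucas 1 d0 j.+1 - lucas 1 d0 j.
have ev : iota v = a ^+ j + b ^+ j.
  apply: (mulfI (_ : a - b != 0)); first by rewrite subr_eq0.
  rewrite rmorphB rmorphM !lucas_map rmorph1 -ab1 -abd rmorph_nat.
  rewrite mulrBr mulrCA !lucas_roots.
  have -> : a ^+ j - b ^+ j = (a + b) * (a ^+ j - b ^+ j) by rewrite ab1 mul1r.
  by rewrite !exprS; ring.
have vn0 : a ^+ j + b ^+ j != 0.
  have -> : a ^+ j + b ^+ j = b ^+ j * (1 + (a / b) ^+ j).
    by rewrite mulrDr mulr1 addrC expr_div_n mulrCA divff ?expf_neq0 ?mulr1.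
  by rewrite mulf_neq0 ?expf_neq0.
(* Multiplying numerator and denominator by b^(2j) turns the ratio into (a b)^j / (a^j + b^j)^2. *)
exists (d0 ^+ j / v ^+ 2).
rewrite rmorphM fmorphV !rmorphXn /= ev -abd /ratio_inv expr_div_n exprMn.
move: zj; rewrite expr_div_n; have bj := expf_neq0 j b0.
move: (a ^+ j) (b ^+ j) vn0 bj => u w uw w0 _.
by field; rewrite w0 addrC uw.
Qed.

Lemma card_lucas_params m : (2 < m)%N -> (m \in [pchar k] -> m = 3%N) ->
  lucas_params m #= `I_((totient m)./2) \/ lucas_params m #= `I_0.
Proof.
move=> m2 mk.
have [->|/eqP/set0P [d0 [d00 od0]]] := pselect (lucas_params m = set0).
  by right; rewrite II0.
(* m = 3 may be the characteristic, so it is done by hand: the third Lucas term is 1 - d, which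
   leaves only d = 1. *)
left; have [m3|m3] := eqVneq m 3%N.
  have -> : lucas_params m = (fun=> 1) @` `I_1.
    apply/seteqP; split=> [d [_ []]|_ [i _ <-]]; rewrite m3.
      rewrite /= !mulr1 mulr0 subr0 mulr1 => _ /subr0_eq <- _.
      by exists 0%N.
    split; first exact: oner_neq0; split=> //=.
      by ring.
    by case=> [|[|[|]]] //= _; rewrite ?mulr1 ?mulr0 ?subr0 oner_neq0.
  rewrite m3; apply: inj_card_eq => i j.
  by rewrite !inE /= !ltnS !leqn0 => /eqP -> /eqP ->.
have {}mk : m \notin [pchar k] by apply: contra m3 => /mk ->.
have [a [b [ab1 abd]]] := quadratic_roots d0.
have nab := lucas_order_separable mk d00 od0 ab1 abd.
have b0 : b != 0.
  by apply: contra d00 => /eqP b0; rewrite -(fmorph_eq0 iota) -abd b0 mulr0.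
have pz := proj1 (lucas_order_primitive m ab1 abd nab b0) od0.
have paramsE := lucas_paramsE m2 mk ab1 abd d00 pz.
have z1 j := prim_root_neqN1 (j := j) m2 pz.
(* The value 0 at j not prime to m is a dummy. *)
have /choice [d ed] : forall j, exists d,
    coprime m j -> iota d = ratio_inv ((a / b) ^+ j).
  move=> j; case cj: (coprime m j); last by exists 0.
  by have [d ?] := ratio_inv_rational ab1 abd nab b0 (z1 j cj); exists d.
move: pz paramsE z1 ed; set z := a / b => pz paramsE z1 ed.
have z0 : z != 0 by rewrite (prim_root_eq0 pz); lia.
set s := [seq j <- seq.iota 0 m | coprime m j && (j.*2 < m)%N].
have sP j : (j \in s) = [&& coprime m j, (j.*2 < m)%N & (j < m)%N].
  by rewrite mem_filter mem_iota -andbA.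
(* Exponents below m / 2 suffice, because m - j gives the inverse root and hence the same
   parameter. *)
have -> : lucas_params m = (d \o nth 0%N s) @` `I_(size s).
  apply/seteqP; split=> [x /paramsE [j /andP [jm cj] ej]|_ [i ims <-]]; last first.
    have := mem_nth 0%N ims; rewrite sP => /and3P [cj _ jm].
    by apply/paramsE; exists (nth 0%N s i); [rewrite jm | apply: ed].
  suff [j' js ej'] : exists2 j', j' \in s & iota x = iota (d j').
    exists (index j' s); first by rewrite /= index_mem.
    by rewrite /= nth_index //; apply/esym/(fmorph_inj iota).
  case: (ltnP j.*2 m) => [j2|j2].
    by exists j; rewrite ?ej ?ed // sP cj j2.
  have j2m := coprime_double_neq m2 cj.
  exists (m - j)%N; first by rewrite sP coprime_subr ?cj /=; lia.
  have ezj : z ^+ (m - j) = (z ^+ j)^-1.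
    apply: (mulfI (expf_neq0 j z0)).
    by rewrite -exprD subnKC ?(ltnW jm) // (prim_expr_order pz) mulfV ?expf_neq0.
  rewrite ed ?coprime_subr ?(ltnW jm) // ej ezj ratio_invV ?expf_neq0 ?z1 //.
rewrite totient_half // -/s.
apply: inj_card_eq => i j; rewrite !inE => si sj /=.
move=> /(congr1 iota).
have := mem_nth 0%N si; have := mem_nth 0%N sj.
rewrite !sP => /and3P [cj j2 jm] /and3P [ci i2 im].
have us : uniq s by rewrite filter_uniq // iota_uniq.
rewrite !ed // => e; apply: (uniqP 0%N us) => //.
(* Either the two powers agree, or they are inverse and m divides the sum of the exponents; that sum
   is below m, so both exponents are 0. *)
case: (ratio_inv_eq (z1 _ ci) (z1 _ cj) e) => /eqP.
  by rewrite (eq_prim_root_expr pz) !modn_small // => /eqP.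
rewrite -exprD -(prim_order_dvd pz).
move: i2 j2; move: (nth _ _ i) (nth _ _ j) => u w u2 w2.
have [uw0|uw0 /(dvdn_leq uw0)] := posnP (u + w); last by lia.
by lia.
Qed.

End Counting.

(* The hypothesis on m and the characteristic p of k only excludes
   m = p >= 5, where the unipotent elements of PGL(2,k) form exactly one
   isomorphy class, of order p, so that C(p,k) = 1 <> (p - 1) / 2. *)
Theorem theorem6p2 (k : fieldType) (K : closedFieldType)
    (iota : {rmorphism k -> K}) (K_alg : forall x : K, algebraicOver iota x)
    (char_k : 2%N \notin [pchar k]) :
  (forall m : nat, (2 < m)%N -> (m \in [pchar k] -> m = 3%N) ->
     isomorphy_classes iota m #= `I_((totient m)./2) \/
     isomorphy_classes iota m #= `I_0) /\
  isomorphy_classes iota 2 #= square_classes k.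
Proof.
split=> [m m2 mk|].
  have m1 : (1 < m)%N := ltnW m2.
  suff e : isomorphy_classes iota m #= @lucas_params k m.
    by have [h|h] := card_lucas_params iota m2 mk; [left | right];
      apply: card_eq_trans e h.
  rewrite (isomorphy_classes_image iota char_k (D := @lucas_params k m)
    (M := companion2 1)).
  - apply: inj_card_eq => d d'; rewrite !inE => -[d0 _] [d'0 _].
    move=> /(eq_isomorphy_class iota); rewrite !companion2_unit => /(_ d0 d'0).
    move=> /(proj_conjP (companion2_nscalar _ _) (companion2_nscalar _ _)).
    rewrite !tr_companion2 !det_companion2 => -[c [_]].
    by rewrite mulr1 => <-; rewrite expr1n mul1r.
  - move=> d [d0 od]; rewrite companion2_unit; split=> //.
    by apply/(proj_orderP _ (companion2_nscalar _ _));
      rewrite tr_companion2 det_companion2.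
  move=> A uA oA; have nA := proj_order_nscalar m1 oA.
  have [m0 e h] := proj1 (proj_orderP m nA) oA.
  (* The second Lucas term is the trace, and 2 < m. Dividing A by its trace then gives the parameter
     det A / (tr A)^2. *)
  have t0 : \tr A != 0.
    by have := h 2; rewrite /= mulr1 mulr0 subr0; apply.
  have dA : \det A != 0 by rewrite -unitfE -unitmxE.
  have lucasE n : \tr A * lucas (\tr A) (\det A) n =
      \tr A ^+ n * lucas 1 (\det A / \tr A ^+ 2) n.
    by rewrite -lucas_scale mulr1 [_ * (_ / _)]mulrC divfK ?expf_neq0.
  exists (\det A / \tr A ^+ 2).
    split; first by rewrite mulf_neq0 // invr_eq0 expf_neq0.
    split=> //.
      by apply: (mulfI (expf_neq0 m t0)); rewrite -lucasE e !mulr0.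
    move=> n /h; apply: contra => /eqP e0.
    by rewrite -(inj_eq (mulfI t0)) lucasE e0 !mulr0.
  apply/(proj_conjP (companion2_nscalar _ _) nA).
  rewrite tr_companion2 det_companion2; exists (\tr A).
  by rewrite t0 mulr1 [_ * (_ / _)]mulrC divfK ?expf_neq0.
pose D : set k := [set a | a != 0].
(* The sign makes the square of [M a] equal to the scalar a. *)
pose M a : 'M[k]_2 := companion2 0 (- a).
have uM a : D a -> M a \in unitmx by rewrite companion2_unit oppr_eq0.
have conjM a b : proj_conj (M a) (M b) <-> exists2 t, t != 0 & b = a * t ^+ 2.
  rewrite proj_conjP ?companion2_nscalar // !tr_companion2 !det_companion2.
  split=> [[c [c0 _ e]]|[c c0 ->]]; exists c => //.
    by rewrite -[b]opprK e mulrN opprK mulrC.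
  by split=> //; [rewrite mulr0 | ring].
pose coset a : set k := [set b | exists2 t : k, t != 0 & b = a * t ^+ 2].
have cosetP a b : coset a = coset b <-> coset a b.
  split=> [->|[t t0 ->]].
    by exists 1; rewrite ?oner_neq0 // expr1n mulr1.
  apply/seteqP; split=> _ [s s0 ->].
    exists (s / t); first by rewrite mulf_neq0 // invr_eq0.
    by field.
  by exists (t * s); [rewrite mulf_neq0 | ring].
rewrite (isomorphy_classes_image iota char_k (D := D) (M := M)); first last.
- move=> A uA oA; have nA := proj_order_nscalar (isT : (1 < 2)%N) oA.
  have [_ e _] := proj1 (proj_orderP 2 nA) oA.
  move: e; rewrite /= mulr1 mulr0 subr0 => tA.
  exists (- \det A); first by rewrite /D /= oppr_eq0 -unitfE -unitmxE.
  apply/(proj_conjP (companion2_nscalar _ _) nA).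
  rewrite tr_companion2 det_companion2 opprK; exists 1.
  by rewrite oner_neq0 tA mulr0 expr1n mul1r.
- move=> a a0; split; first exact: uM.
  apply/(proj_orderP _ (companion2_nscalar _ _)); rewrite tr_companion2.
  by split=> //=; [rewrite mul0r mulr0 subr0 | case=> [|[|]] // _; exact: oner_neq0].
(* Picks an element of the coset; the default 0 is not reached, since cosets are nonempty. By
   [conjM] the class does not depend on the choice. *)
pose H (C : set k) := isomorphy_class iota (Inn (map_mx iota (M (xget 0 C)))).
have HE a : D a -> H (coset a) = isomorphy_class iota (Inn (map_mx iota (M a))).
  move=> a0; have [t t0 e] : coset a (xget 0 (coset a)).
    by apply: (@xgetPex _ 0 (coset a)); exists a; exists 1;
      rewrite ?oner_neq0 // expr1n mulr1.
  apply/esym/(eq_isomorphy_class iota (uM _ a0)).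
    by apply: uM; rewrite /D /= e mulf_neq0 // expf_neq0.
  by apply/conjM; exists t.
have -> : (fun a => isomorphy_class iota (Inn (map_mx iota (M a)))) @` D =
    H @` square_classes k.
  apply/seteqP; split=> [_ [a a0 <-]|_ [_ [a a0 ->] <-]].
    by exists (coset a); [exists a | exact: HE].
  by exists a => //; rewrite HE.
apply: inj_card_eq => C C'; rewrite !inE => -[a a0 ->] [b b0 ->].
rewrite -/(coset a) -/(coset b) !HE //.
move=> /(eq_isomorphy_class iota (uM _ a0) (uM _ b0)) /conjM ?.
exact/cosetP.
Qed.
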